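(* Let $S\subset\mathbb{R}^3$ be a compact convex solid of volume $V>0$ that is centrally symmetric with respect to a point $C$ (i.e. for every $P\in S$ the point $P'$ with $\overrightarrow{CP}+\overrightarrow{CP'}=0$ also lies in $S$). Suppose $S$ is contained in the half-space $\{z\ge 0\}$ and touches the plane $z=0$ (the orifice is at the bottom of the solid, located in the $xy$-plane), and let $h_C>0$ be the $z$-coordinate (altitude) of $C$. Let $K>0$ be a constant and define the drainage time $$T=\frac{1}{K}\iiint_S \frac{1}{\sqrt{z}}\,dx\,dy\,dz .$$ Then $$\frac{V}{K\sqrt{h_C}}\le T\le \frac{\sqrt{2}\,V}{K\sqrt{h_C}}.$$
   Context: This $T$ is the total drainage time given by Torricelli's law $A(h)\,h'(t)=-ka\sqrt{2gh}$ for a container of shape $S$ with a small hole at its lowest point, where $A(h)$ is the area of the horizontal cross-section of $S$ at height $h$ and $K=ka\sqrt{2g}$; equivalently $T=\frac1K\int_0^H A(h)h^{-1/2}\,dh$, with $H$ the height of $S$. *)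

(* Defs.v *)
From mathcomp Require Import all_boot all_order all_algebra.
From mathcomp Require Import all_classical all_reals all_analysis.
Set Implicit Arguments. Unset Strict Implicit. Unset Printing Implicit Defensive.
Import Order.TTheory GRing.Theory Num.Theory numFieldNormedType.Exports.
Local Open Scope ring_scope.
Local Open Scope classical_set_scope.

Notation pt3 R := ((R * R) * R)%type.

Definition xc {R : realType} (p : pt3 R) : R := p.1.1.
Definition yc {R : realType} (p : pt3 R) : R := p.1.2.
Definition zc {R : realType} (p : pt3 R) : R := p.2.

Definition leb3 (R : realType) :=
  ((@lebesgue_measure R \x @lebesgue_measure R) \x @lebesgue_measure R)%E.

Definition comb3 {R : realType} (t : R) (p q : pt3 R) : pt3 R :=
  ((t * xc p + (1 - t) * xc q, t * yc p + (1 - t) * yc q),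
    t * zc p + (1 - t) * zc q).

Definition convex3 {R : realType} (S : set (pt3 R)) : Prop :=
  forall p q t, S p -> S q -> 0 <= t <= 1 -> S (comb3 t p q).

Definition refl3 {R : realType} (C p : pt3 R) : pt3 R :=
  ((2 * xc C - xc p, 2 * yc C - yc p), 2 * zc C - zc p).

Definition centrally_symmetric {R : realType} (S : set (pt3 R)) (C : pt3 R) : Prop :=
  forall p, S p -> S (refl3 C p).

(* Main.v *)
(* Let A(z) be the area of the slice of S at height z, and h the altitude of C, so
   that V and K T are the integrals of A(z) and A(z) / sqrt z.  Central symmetry
   gives A(2 h - z) = A(z), hence 2 K T is the integral of A g, where
   g(z) = 1 / sqrt z + 1 / sqrt (2 h - z) is at least 2 / sqrt h: this is the lower
   bound.  For the upper bound, the slice at height w = t z + (1 - t) (2 h - z)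
   contains t S_z + (1 - t) (2 C - S_z), whose area is at least that of S_z by
   Brunn-Minkowski; so A increases up to height h while g decreases there, and
   Chebyshev's inequality bounds the mean of A g by the product of the mean of A
   and the mean 2 sqrt 2 / sqrt h of g over ]0, 2 h[. *)
From HB Require Import structures.
Require Import Defs.
From mathcomp Require Import all_boot all_order all_algebra.
From mathcomp Require Import all_classical all_reals all_analysis.
From mathcomp Require Import measurable_realfun lra ring.
Import Order.TTheory GRing.Theory Num.Theory numFieldNormedType.Exports.
Local Open Scope ring_scope.
Local Open Scope classical_set_scope.

(** The product measure is defined through sections in the other direction; uniqueness on rectangles
    identifies the two iterated integrals. *)
Lemma product_measure_ysection {d1 d2 : measure_display}
    {T1 : measurableType d1} {T2 : measurableType d2} {R : realType}
    (m1 : {sigma_finite_measure set T1 -> \bar R})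
    (m2 : {sigma_finite_measure set T2 -> \bar R}) (A : set (T1 * T2)) :
  measurable A -> (m1 \x m2)%E A = (\int[m2]_y m1 (ysection A y))%E.
Proof.
move=> mA; rewrite -[RHS]/((m1 \x^ m2)%E A).
by apply: product_measure_unique => //= *; rewrite product_measure2E.
Qed.

(** * Brunn-Minkowski in the plane, by lengths of sections *)

Section planar.
Context {R : realType}.
Notation mu := (@lebesgue_measure R).
Notation mR := (measurableTypeR R).
Notation measurable2 := (@measurable _ (mR * mR)%type).

(** The set lies in [[inf I, sup I]]. Together with the reverse bound for intervals proved next,
    this turns comparisons of measures into comparisons of pairs of points. *)
Lemma lebesgue_measure_le_diameter (I : set R) (m : \bar R) :
  measurable I -> (0 <= m)%E ->
  (forall a b, I a -> I b -> ((b - a)%:E <= m)%E) -> (mu I <= m)%E.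
Proof.
move=> mI; case: m => [m||] // m0 Im; last by rewrite leey.
rewrite lee_fin in m0.
have [->|/set0P[x0 Ix0]] := eqVneq I set0; first by rewrite measure0 lee_fin.
have ubI : has_sup I.
  split; first by exists x0.
  exists (x0 + m) => b Ib; have := Im _ _ Ix0 Ib; rewrite lee_fin; lra.
have lbI : has_inf I.
  split; first by exists x0.
  exists (x0 - m) => b Ib; have := Im _ _ Ib Ix0; rewrite lee_fin; lra.
have sub : I `<=` `[inf I, sup I].
  move=> x Ix /=; rewrite in_itv/=; apply/andP; split.
    by apply: ge_inf => //; case: lbI.
  by apply: ub_le_sup => //; case: ubI.
have supm : sup I <= m + inf I.
  apply: ge_sup; first by exists x0.
  move=> b Ib; rewrite -lerBlDl; apply: lb_le_inf; first by exists x0.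
  by move=> a Ia; have := Im _ _ Ia Ib; rewrite lee_fin; lra.
have : (mu I <= mu `[inf I, sup I])%E by apply: le_measure; rewrite ?inE.
move=> /le_trans; apply.
rewrite lebesgue_measure_itv/= lte_fin; case: ifPn => _; rewrite ?lee_fin//.
by rewrite lerBlDr.
Qed.

Lemma lebesgue_measure_interval_ge (J : set R) (a b : R) :
  measurable J -> is_interval J -> J a -> J b -> ((b - a)%:E <= mu J)%E.
Proof.
move=> mJ iJ Ja Jb; have [ab|ba] := leP a b; last first.
  by apply: le_trans (measure_ge0 mu J); rewrite lee_fin; lra.
have sub : `[a, b] `<=` J.
  by move=> x /=; rewrite in_itv/= => abx; exact: (iJ a b).
have : (mu `[a, b] <= mu J)%E by apply: le_measure; rewrite ?inE.
apply: le_trans.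
rewrite lebesgue_measure_itv/= lte_fin; case: ltP => //= h; rewrite lee_fin; lra.
Qed.

(** The strict upper bound makes the section at [y] the interval [[0, f y[], of length [f y] even
    when that value is infinite. *)
Let hypograph (f : R -> \bar R) : set (R * R) :=
  [set p | 0 <= p.2 /\ (p.2%:E < f p.1)%E].

Let measurable_hypograph (f : R -> \bar R) :
  @measurable_fun _ _ mR _ setT f -> measurable2 (hypograph f).
Proof.
move=> mf.
rewrite (_ : hypograph f = (snd @^-1` `[0, +oo[%classic) `&`
    ([set: mR * mR] `&` [set p | (p.2%:E < f p.1)%E])); last first.
  by apply/seteqP; split=> p /=; rewrite /hypograph/= in_itv/= andbT; tauto.
apply: measurableI.
  by rewrite -[X in measurable X]setTI; exact: measurable_snd.
apply: measurable_lte => //.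
  by apply/measurable_EFinP; exact: measurable_snd.
by apply: measurableT_comp => //; exact: measurable_fst.
Qed.

Let xsection_hypograph (f : R -> \bar R) y : (0 <= f y)%E ->
  mu (xsection (hypograph f) y) = f y.
Proof.
move=> fy0.
have -> : xsection (hypograph f) y = [set s | 0 <= s /\ (s%:E < f y)%E].
  by rewrite xsectionE.
case fyE : (f y) => [r| |].
- rewrite (_ : [set _ | _] = `[0, r[%classic); last first.
    by apply/seteqP; split=> s /=; rewrite in_itv/= lte_fin; [case=> -> ->|move=> /andP[]].
  rewrite lebesgue_measure_itv/= lte_fin oppr0 adde0.
  by move: fy0; rewrite fyE lee_fin le_eqVlt; case: ltP => //; rewrite orbF => _ /eqP <-.
- rewrite (_ : [set _ | _] = `[0, +oo[%classic); last first.
    apply/seteqP; split=> s /=; rewrite in_itv/= andbT; first by case.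
    by move=> ->; rewrite ltry.
  by rewrite lebesgue_measure_itv/= ltry.
- by rewrite fyE in fy0.
Qed.

(* Layer cake: both integrals are the planar measures of the hypographs. *)
Lemma le_integral_superlevel (f g : R -> \bar R) :
  @measurable_fun _ _ mR _ setT f -> @measurable_fun _ _ mR _ setT g ->
  (forall y, 0 <= f y)%E -> (forall y, 0 <= g y)%E ->
  (forall s : R, 0 <= s ->
    (mu [set y | (s%:E < f y)%E] <= mu [set y | (s%:E < g y)%E])%E) ->
  (\int[mu]_y f y <= \int[mu]_y g y)%E.
Proof.
move=> mf mg f0 g0 fg.
have layer (k : R -> \bar R) : @measurable_fun _ _ mR _ setT k -> (forall y, 0 <= k y)%E ->
    (\int[mu]_y k y = \int[mu]_s mu (ysection (hypograph k) s))%E.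
  move=> mk k0; have mH := measurable_hypograph k mk.
  under eq_integral do rewrite -(xsection_hypograph k)//.
  exact: (product_measure_ysection mu mu).
rewrite (layer f)// (layer g)//; apply: ge0_le_integral => //.
- by apply: (measurable_fun_ysection mu); exact: measurable_hypograph.
- by apply: (measurable_fun_ysection mu); exact: measurable_hypograph.
move=> s _; have ysE (k : R -> \bar R) :
    ysection (hypograph k) s = [set y | 0 <= s /\ (s%:E < k y)%E].
  by rewrite ysectionE.
(* At a negative height both sections are empty, so only levels [s >= 0] have to be compared. *)
rewrite !ysE; have [s0|s0] := leP 0 s; last first.
  rewrite (_ : [set y | _ /\ (_ < f y)%E] = set0) ?measure0//.
  by apply/seteqP; split=> // y /= [].
have eqk (k : R -> \bar R) : [set y | true /\ (s%:E < k y)%E] = [set y | (s%:E < k y)%E].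
  by apply/seteqP; split=> y /= => [[]|].
by rewrite !eqk; exact: fg.
Qed.

(* A planar Brunn-Minkowski inequality restricted to a set and its reflection:
   the superlevel sets of the section lengths reduce it to the line, where the
   extreme pairs (a, c - b) and (b, c - a) combine to points b - a apart. *)
Lemma product_lebesgue_measure_le_comb (D E : set (R * R)) (c : R * R) (t : R) :
  measurable2 D -> measurable2 E -> 0 <= t <= 1 ->
  (forall p q s, E p -> E q -> 0 <= s <= 1 ->
    E (s * p.1 + (1 - s) * q.1, s * p.2 + (1 - s) * q.2)) ->
  (forall p q, D p -> D q ->
    E (t * p.1 + (1 - t) * (c.1 - q.1), t * p.2 + (1 - t) * (c.2 - q.2))) ->
  ((mu \x mu) D <= (mu \x mu) E)%E.
Proof.
move=> mD mE t01 cE DE; rewrite !product_measure_ysection//.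
have mDy y : measurable (ysection D y) by exact: measurable_ysection.
have mEy y : measurable (ysection E y) by exact: measurable_ysection.
have mlen (B : set (R * R)) : measurable2 B ->
    @measurable_fun _ _ mR _ setT (fun y => mu (ysection B y)).
  exact: (measurable_fun_ysection mu).
have msup (B : set (R * R)) s : measurable2 B ->
    measurable [set y | (s%:E < mu (ysection B y))%E].
  move=> mB; rewrite -[X in measurable X]setTI.
  by apply: measurable_lte => //; exact: mlen.
have convexE (p q : R) s : p < q -> p <= s <= q ->
    exists2 u, 0 <= u <= 1 & s = u * p + (1 - u) * q.
  move=> pq /andP[ps sq]; exists ((q - s) / (q - p)).
    by rewrite divr_ge0 ?ler_pdivrMr ?mul1r/=; lra.
  by field; rewrite gt_eqF// subr_gt0.
have iEy y : is_interval (ysection E y).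
  rewrite ysectionE => a b Ea Eb s asb /=.
  have [ab|ba] := ltP a b; last first.
    by rewrite (_ : s = a)//; lra.
  have [u u01 ->] := convexE _ _ _ ab asb.
  by have := cE _ _ _ Ea Eb u01; rewrite /= (_ : _ * y + _ = y)//; ring.
(* Contrapositive of the diameter bound: a section longer than [s] contains two points more than [s]
   apart. *)
have long (B : set (R * R)) s y : measurable2 B -> 0 <= s ->
    (s%:E < mu (ysection B y))%E -> exists a b, [/\ B (a, y), B (b, y) & s < b - a].
  move=> mB s0; apply: contraPP => nab; apply/negP; rewrite -leNgt.
  apply: lebesgue_measure_le_diameter => [||a b]; first exact: measurable_ysection.
    by rewrite lee_fin.
  rewrite ysectionE/= => Ba Bb; rewrite lee_fin leNgt; apply/negP => sab.
  by apply: nab; exists a, b.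
apply: le_integral_superlevel; [exact: mlen|exact: mlen|by []|by []|].
(* The same principle now applies in the other coordinate: any two heights in the superlevel set of
   [D] must yield two heights equally far apart in that of [E], which is an interval. *)
move=> s s0; apply: lebesgue_measure_le_diameter => //; first exact: msup.
move=> y1 y2 /= /(long _ _ _ mD s0)[a1 [b1 [Da1 Db1 ab1]]].
move=> /(long _ _ _ mD s0)[a2 [b2 [Da2 Db2 ab2]]].
have lenE y x x' : E (x, y) -> E (x', y) -> s < x' - x ->
    (s%:E < mu (ysection E y))%E.
  move=> Ex Ex' sx; apply: (@lt_le_trans _ _ (x' - x)%:E); first by rewrite lte_fin.
  by apply: lebesgue_measure_interval_ge; rewrite // ysectionE.
(* Reflection reverses order, so each [y] is mixed with the reflection of the other one; both
   weights then contribute [y2 - y1]. *)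
have -> : y2 - y1 = (t * y2 + (1 - t) * (c.2 - y1)) - (t * y1 + (1 - t) * (c.2 - y2)).
  by ring.
have mixlt (u p q : R) : 0 <= u <= 1 -> s < p -> s < q -> s < u * p + (1 - u) * q.
  move=> /andP[u0 u1] sp sq; have [->|u0'] := eqVneq u 0; first by lra.
  have : 0 < u * (p - s) by rewrite mulr_gt0 ?subr_gt0// lt_def u0'.
  have : 0 <= (1 - u) * (q - s) by rewrite mulr_ge0// subr_ge0// ltW.
  lra.
apply: lebesgue_measure_interval_ge => //; first exact: msup.
(* Interval property: mixing left ends with left ends and right ends with right ends keeps the gap
   above [s]. *)
- move=> p q /= /(long _ _ _ mE s0)[a [b [Ea Eb ab]]].
  move=> /(long _ _ _ mE s0)[a' [b' [Ea' Eb' ab']]] r prq.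
  have [pq|qp] := ltP p q; last first.
    by rewrite (_ : r = p); [exact: (lenE _ a b)|lra].
  have [u u01 ->] := convexE _ _ _ pq prq.
  have /= Ex := cE _ _ _ Ea Ea' u01.
  have /= Ex' := cE _ _ _ Eb Eb' u01.
  by apply: (lenE _ _ _ Ex Ex'); have := mixlt _ _ _ u01 ab ab'; lra.
(* The gap between the two mixed points is [t * (b1 - a1) + (1 - t) * (b2 - a2)]. *)
- have /= Ex := DE _ _ Da1 Db2.
  have /= Ex' := DE _ _ Db1 Da2.
  apply: (lenE _ _ _ Ex Ex').
  have := mixlt _ _ _ t01 ab1 ab2; lra.
- have /= Ex := DE _ _ Da2 Db1.
  have /= Ex' := DE _ _ Db2 Da1.
  apply: (lenE _ _ _ Ex Ex').
  have := mixlt _ _ _ t01 ab2 ab1; lra.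
Qed.

End planar.

(** * Reflection of integrals on the line, and the integral of [1 / sqrt x] *)

Section line.
Context {R : realType}.
Notation mu := (@lebesgue_measure R).
Notation mR := (measurableTypeR R).

(** The image of Lebesgue measure under [x |-> c - x] gives each interval []a, b]] its length, hence
    is Lebesgue measure. *)
Lemma ge0_integral_reflect (c : R) (k : R -> \bar R) :
  measurable_fun [set: R] k -> (forall x, 0 <= k x)%E ->
  (\int[mu]_x k (c - x)%R = \int[mu]_x k x)%E.
Proof.
move=> mk k0.
pose phi : mR -> mR := fun x : R => c - x.
have mphi : measurable_fun setT phi by exact: measurable_funB.
have := ge0_integral_pushforward mphi mu measurableT mk (fun x _ => k0 x).
rewrite preimage_setT => <-; apply: eq_measure_integral => //= A mA _.
pose nu := (pushforward mu phi : {measure set mR -> \bar R}).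
apply/esym; apply: (@lebesgue_measure_unique _ (nu mphi)) => // _ [[a b]] _ <-.
rewrite -[RHS]/(mu (phi @^-1` `]a, b])).
rewrite (_ : phi @^-1` _ = `[c - b, c - a[%classic); last first.
  have abE (x : R) : (a < c - x <= b) = (c - b <= x < c - a).
    by apply/idP/idP => /andP[? ?]; apply/andP; split; lra.
  by apply/seteqP; split=> x /=; rewrite !in_itv/= /phi abE.
rewrite !lebesgue_measure_itv/= !lte_fin ltrD2l ltrN2; case: ifPn => // _.
by rewrite -!EFinB; congr EFin; ring.
Qed.

Lemma continuous_inv_sqrt (x : R) : 0 < x -> {for x, continuous (fun x : R => (Num.sqrt x)^-1)}.
Proof.
move=> x0; apply: continuousV; first by rewrite gt_eqF// sqrtr_gt0.
exact: sqrt_continuous.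
Qed.

Lemma measurable_inv_sqrt : measurable_fun [set: R] (fun x : R => (Num.sqrt x)^-1).
Proof.
(* For [x <= 0] both [Num.sqrt x] and the inverse of [0] take the default value [0]. *)
have -> : (fun x : R => (Num.sqrt x)^-1) =
    (fun x => if 0 < x then (Num.sqrt x)^-1 else 0).
  apply/funext => x; case: ltP => // x0.
  by rewrite ler0_sqrtr// invr0.
apply: measurable_fun_if => //; first exact: measurable_fun_ltr.
rewrite setTI (_ : _ @^-1` _ = `]0, +oo[%classic); last first.
  by apply/seteqP; split=> x /=; rewrite in_itv/= andbT.
apply: open_continuous_measurable_fun; first exact: interval_open.
by move=> x; rewrite inE/= in_itv/= andbT; exact: continuous_inv_sqrt.
Qed.

(** The primitive [2 sqrt x] bounds the integral over [[a, b]] for every [a > 0]; monotone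
    convergence along [[1 / (n + 1), b]] handles the singularity at [0]. *)
Lemma integral_inv_sqrt_le (b : R) : 0 < b ->
  (\int[mu]_(x in `]0%R, b[) ((Num.sqrt x)^-1)%:E <= (2 * Num.sqrt b)%:E)%E.
Proof.
move=> b0.
have cc a : 0 < a -> a < b ->
    (\int[mu]_(x in `[a, b]) ((Num.sqrt x)^-1)%:E <= (2 * Num.sqrt b)%:E)%E.
  move=> a0 ab.
  rewrite (@continuous_FTC2 _ _ (fun x => 2 * Num.sqrt x) _ _ ab); last 3 first.
  - by apply: continuous_in_subspaceT => x; rewrite inE/= in_itv/= => /andP[ax _];
      apply: continuous_inv_sqrt; exact: lt_le_trans ax.
  - split.
    + by move=> x; rewrite in_itv/= => /andP[ax _]; apply: derivableM => //;
        apply: (@ex_derive _ _ _ _ _ _ _ (is_derive1_sqrt _)); exact: lt_trans ax.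
    + apply: cvg_at_right_filter; apply: cvgM; first exact: cvg_cst.
      exact: sqrt_continuous.
    + apply: cvg_at_left_filter; apply: cvgM; first exact: cvg_cst.
      exact: sqrt_continuous.
  - move=> x; rewrite in_itv/= => /andP[ax _].
    have x0 : 0 < x by exact: lt_trans ax.
    have sx0 : Num.sqrt x != 0 by rewrite gt_eqF// sqrtr_gt0.
    have dx := is_derive1_sqrt x0.
    rewrite derive1E deriveM ?derive_cst ?derive_val//.
    by rewrite scaler0 addr0 /GRing.scale/=; field.
  rewrite -EFinB lee_fin lerBlDr lerDl mulr_ge0// sqrtr_ge0.
pose F (n : nat) := `[n.+1%:R^-1 : R, b]%classic.
have mF n : measurable (F n) by exact: measurable_itv.
have f0 (x : R) : (0 <= ((Num.sqrt x)^-1)%:E)%E by rewrite lee_fin invr_ge0 sqrtr_ge0.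
have mf (D : set R) : measurable D -> measurable_fun D (fun x : R => ((Num.sqrt x)^-1)%:E).
  by move=> mD; apply/measurable_EFinP; apply: measurable_funTS; exact: measurable_inv_sqrt.
have ndF : nondecreasing_seq F.
  move=> m n mn; apply/subsetPset => x /=; rewrite /F/= !in_itv/= => /andP[+ ->].
  rewrite andbT; apply: le_trans.
  by rewrite lef_pV2 ?posrE// ler_nat.
have cv := @ge0_nondecreasing_set_cvg_integral _ mR R F (fun x : R => ((Num.sqrt x)^-1)%:E) mu
  ndF mF (fun n => mf _ (mF n)) (fun n x _ => f0 x).
have sub : `]0%R, b[ `<=` \bigcup_n F n.
  move=> x /=; rewrite in_itv/= => /andP[x0 xb].
  exists (Num.truncn x^-1) => //; rewrite /F/= in_itv/= (ltW xb) andbT.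
  rewrite -[leRHS]invrK lef_pV2 ?posrE ?invr_gt0// ltW//.
  exact: truncnS_gt.
apply: (@le_trans _ _ (\int[mu]_(x in \bigcup_n F n) ((Num.sqrt x)^-1)%:E)%E).
  have mU : @measurable _ R (\bigcup_n F n) by exact: bigcupT_measurable.
  by apply: ge0_subset_integral => //; exact: mf.
rewrite -(cvg_lim _ cv)//; apply: lime_le; first by apply/cvg_ex; eexists; exact: cv.
near=> n; have [nb|bn] := ltP (n.+1%:R^-1 : R) b; first exact: cc.
(* For small [n] the interval [F n] may be a point or empty. *)
suff : (\int[mu]_(x in F n) ((Num.sqrt x)^-1)%:E = 0)%E.
  by move=> ->; rewrite lee_fin mulr_ge0// sqrtr_ge0.
move: bn; rewrite le_eqVlt => /orP[/eqP bE|bn].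
  by rewrite /F -bE set_itv1 integral_set1.
by rewrite /F set_itv_ge ?integral_set0// bnd_simp -ltNge.
Unshelve. all: by end_near. Qed.

End line.

(** * The function [g]: its minimum and where it crosses its mean *)

Section algebra.
Context {R : realType}.

Let ler_sqr2 (a b : R) : 0 <= a -> 0 <= b -> (a <= b) = (a ^+ 2 <= b ^+ 2).
Proof. by move=> a0 b0; rewrite ler_pXn2r. Qed.

(** With [p = sqrt (z (2 h - z))], the square of the right-hand side is [(2 h + 2 p) / p^2], and
    [p <= h] by the inequality of arithmetic and geometric means. *)
Lemma inv_sqrt_pair_ge (h z : R) : 0 < z -> z < 2 * h ->
  2 / Num.sqrt h <= (Num.sqrt z)^-1 + (Num.sqrt (2 * h - z))^-1.
Proof.
move=> z0 zh.
have u0 : 0 < Num.sqrt z by rewrite sqrtr_gt0.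
have v0 : 0 < Num.sqrt (2 * h - z) by rewrite sqrtr_gt0; lra.
have s0 : 0 < Num.sqrt h by rewrite sqrtr_gt0; lra.
have u2 : Num.sqrt z ^+ 2 = z by rewrite sqr_sqrtr// ltW.
have v2 : Num.sqrt (2 * h - z) ^+ 2 = 2 * h - z by rewrite sqr_sqrtr//; lra.
have s2 : Num.sqrt h ^+ 2 = h by rewrite sqr_sqrtr//; lra.
move: u0 v0 s0 u2 v2 s2; set u := Num.sqrt z; set v := Num.sqrt _; set s := Num.sqrt h.
move=> u0 v0 s0 u2 v2 s2.
have p0 : 0 < u * v by rewrite mulr_gt0.
have ps : u * v <= s ^+ 2 by have := sqr_ge0 (u - v); nra.
have -> : u^-1 + v^-1 = (u + v) / (u * v).
  by field; rewrite !gt_eqF.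
rewrite ler_pdivrMr// mulrAC ler_pdivlMr//.
have us0 : 0 <= (u + v) * s by rewrite mulr_ge0 ?addr_ge0 ?(ltW u0) ?(ltW v0) ?(ltW s0).
rewrite ler_sqr2//; last by rewrite mulr_ge0// ltW.
have -> : ((u + v) * s) ^+ 2 = (2 * s ^+ 2 + 2 * (u * v)) * s ^+ 2.
  by rewrite exprMn sqrrD u2 v2 s2; ring.
have -> : (2 * (u * v)) ^+ 2 = 4 * (u * v) * (u * v) by ring.
have key (P Q : R) : 0 < P -> P <= Q -> 4 * P * P <= (2 * Q + 2 * P) * Q by nra.
exact: key.
Qed.

(* With [p = sqrt (z (2 h - z))] the comparison reads [4 p^2 - h p - h^2 <= 0],
   whose positive root is [h (1 + sqrt 17) / 8]. *)
Lemma inv_sqrt_pair_crossing (h : R) : 0 < h -> exists d, [/\ 0 < d, d < h &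
  forall z, 0 < z -> z < 2 * h ->
  let g := (Num.sqrt z)^-1 + (Num.sqrt (2 * h - z))^-1 in
  let c := 2 * Num.sqrt 2 / Num.sqrt h in
  (d <= `|z - h| -> c <= g) /\ (`|z - h| <= d -> g <= c)].
Proof.
move=> h0; pose r : R := Num.sqrt 17.
have r2 : r ^+ 2 = 17 by rewrite sqr_sqrtr.
have r0 : 0 <= r by exact: sqrtr_ge0.
have r4 : 4 < r by rewrite ltNge; apply/negP => r4; nra.
have r5 : r < 5 by rewrite ltNge; apply/negP => r5; nra.
pose p0 := h * (1 + r) / 8.
have p00 : 0 < p0 by rewrite /p0; nra.
have p0h : p0 < h by rewrite /p0; nra.
have d2 : 0 < h ^+ 2 - p0 ^+ 2 by nra.
(* Since [p^2 = h^2 - (z - h)^2], the condition [d <= |z - h|] amounts to [p <= p0], with [p0] the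
   positive root. *)
exists (Num.sqrt (h ^+ 2 - p0 ^+ 2)); split.
- by rewrite sqrtr_gt0.
- rewrite -[ltRHS](@ger0_norm _ h) ?ltW// -sqrtr_sqr ltr_sqrt; nra.
move=> z z0 zh g c.
have u0 : 0 < Num.sqrt z by rewrite sqrtr_gt0.
have v0 : 0 < Num.sqrt (2 * h - z) by rewrite sqrtr_gt0; lra.
have s0 : 0 < Num.sqrt h by rewrite sqrtr_gt0; lra.
have u2 : Num.sqrt z ^+ 2 = z by rewrite sqr_sqrtr// ltW.
have v2 : Num.sqrt (2 * h - z) ^+ 2 = 2 * h - z by rewrite sqr_sqrtr//; lra.
have s2 : Num.sqrt h ^+ 2 = h by rewrite sqr_sqrtr//; lra.
rewrite /g /c.
move: u0 v0 s0 u2 v2 s2; set u := Num.sqrt z; set v := Num.sqrt (2 * h - z).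
set s := Num.sqrt h => u0 v0 s0 u2 v2 s2.
have p_gt0 : 0 < u * v by rewrite mulr_gt0.
have pE : (u * v) ^+ 2 = h ^+ 2 - (z - h) ^+ 2 by rewrite exprMn u2 v2; ring.
have w2 : Num.sqrt 2 ^+ 2 = 2 :> R by rewrite sqr_sqrtr.
have gE : u^-1 + v^-1 = (u + v) / (u * v) by field; rewrite !gt_eqF.
have lhs2 : ((u + v) * s) ^+ 2 = (2 * h + 2 * (u * v)) * h.
  by rewrite exprMn sqrrD u2 v2 s2; ring.
have rhs2 : (2 * Num.sqrt 2 * (u * v)) ^+ 2 = 8 * (u * v) ^+ 2.
  by rewrite !exprMn w2; ring.
(* The difference of the squares of the two sides, factored at its roots; the last factor is
   positive, so the sign is that of [p0 - u * v]. *)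
have quad : (2 * h + 2 * (u * v)) * h - 8 * (u * v) ^+ 2 =
    8 * (p0 - u * v) * (u * v + h * (r - 1) / 8).
  transitivity (2 * h * (u * v) + (r ^+ 2 - 1) / 8 * h ^+ 2 - 8 * (u * v) ^+ 2).
    by rewrite r2; field.
  by rewrite /p0; field.
have us0 : 0 <= (u + v) * s by rewrite mulr_ge0 ?addr_ge0 ?(ltW u0) ?(ltW v0) ?(ltW s0).
have ws0 : 0 <= 2 * Num.sqrt 2 * (u * v) by rewrite !mulr_ge0 ?sqrtr_ge0 ?(ltW u0) ?(ltW v0).
have pos : 0 < u * v + h * (r - 1) / 8 by nra.
split.
- move=> dz; have pp0 : u * v <= p0.
    rewrite ler_sqr2 ?(ltW p_gt0) ?(ltW p00)//.
    move: dz; rewrite -[leRHS]sqrtr_sqr ler_sqrt ?sqr_ge0 ?(ltW d2)//.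
    lra.
  rewrite gE ler_pdivlMr// mulrAC ler_pdivrMr//.
  rewrite ler_sqr2//.
  by rewrite lhs2 rhs2 -subr_ge0 quad (mulr_ge0 _ (ltW pos))// mulr_ge0// subr_ge0.
- move=> dz; have pp0 : p0 <= u * v.
    rewrite ler_sqr2 ?(ltW p_gt0) ?(ltW p00)//.
    move: dz; rewrite -[leLHS]sqrtr_sqr ler_sqrt ?sqr_ge0 ?(ltW d2)//.
    lra.
  rewrite gE ler_pdivrMr// mulrAC ler_pdivlMr//.
  rewrite ler_sqr2//.
  by rewrite lhs2 rhs2 -subr_le0 quad (mulr_le0_ge0 _ (ltW pos))// mulr_ge0_le0// subr_le0.
Qed.
End algebra.

(** * Integrals of a symmetric area function against [1 / sqrt z] *)

Section weighted.
Context {R : realType}.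
Notation mu := (@lebesgue_measure R).

Variables (h V : R) (A : R -> \bar R).
Hypotheses (h0 : 0 < h) (mA : measurable_fun [set: R] A).
Hypotheses (A0 : forall z, (0 <= A z)%E) (Asym : forall z, A (2 * h - z) = A z).
Hypothesis Aneg : forall z, z < 0 -> A z = 0%E.
Hypothesis AV : (\int[mu]_z A z = V%:E)%E.

Let f (z : R) : R := (Num.sqrt z)^-1.
Let g (z : R) : R := f z + f (2 * h - z).

Let f_ge0 z : 0 <= f z. Proof. by rewrite invr_ge0 sqrtr_ge0. Qed.
Let g_ge0 z : 0 <= g z. Proof. by rewrite addr_ge0. Qed.
Let mf : measurable_fun [set: R] f. Proof. exact: measurable_inv_sqrt. Qed.
Let mfr : measurable_fun [set: R] (fun z => f (2 * h - z)).
Proof. by apply: measurableT_comp => //; exact: measurable_funB. Qed.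
Let mg : measurable_fun [set: R] g. Proof. exact: measurable_funD. Qed.

Let mAD (D : set R) : measurable_fun D A. Proof. exact: measurable_funTS. Qed.

Let measurable_fin (D : set R) (k : R -> R) : measurable_fun [set: R] k ->
  measurable_fun D (fun z => (k z)%:E).
Proof. by move=> mk; apply/measurable_EFinP; exact: measurable_funTS. Qed.

Let mAM (D : set R) (k : R -> R) : measurable_fun [set: R] k ->
  measurable_fun D (fun z => A z * (k z)%:E)%E.
Proof.
move=> mk; apply: measurable_funTS.
by apply: emeasurable_funM => //; exact/measurable_EFinP.
Qed.

Let AM_ge0 (k : R -> R) : (forall z, 0 <= k z) -> forall z, (0 <= A z * (k z)%:E)%E.
Proof. by move=> k0 z; rewrite mule_ge0// lee_fin. Qed.

(** [A] vanishes below [0], hence by symmetry above [2 h]; the two end points are negligible. *)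
Let integral_open (k : R -> R) : measurable_fun [set: R] k ->
  (\int[mu]_z (A z * (k z)%:E) = \int[mu]_(z in `]0%R, (2 * h)%R[) (A z * (k z)%:E))%E.
Proof.
move=> mk; rewrite integral_itv_bndo_bndc; last exact: mAM.
rewrite integral_itv_obnd_cbnd; last exact: mAM.
rewrite [RHS]integral_mkcond; apply: eq_integral => z _.
rewrite patchE; case: ifPn => //; rewrite notin_setE/= in_itv/= => zI.
have [z0|z0] := ltP z 0; first by rewrite Aneg// mul0e.
rewrite -Asym Aneg ?mul0e// ltNge; apply/negP => hz; apply: zI.
by rewrite z0/=; lra.
Qed.

Let twice : (\int[mu]_z (A z * (f z)%:E) + \int[mu]_z (A z * (f z)%:E) =
  \int[mu]_z (A z * (g z)%:E))%E.
Proof.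
rewrite -[in X in (_ + X)%E](@ge0_integral_reflect _ (2 * h))//; last 2 first.
- exact: mAM.
- exact: AM_ge0.
under [in X in (_ + X)%E]eq_integral do rewrite Asym.
rewrite -ge0_integralD//.
- by apply: eq_integral => z _; rewrite /g EFinD ge0_muleDr// lee_fin.
- by move=> z _; exact: AM_ge0.
- exact: mAM.
- by move=> z _; exact: (AM_ge0 (fun z => f (2 * h - z))).
- exact: mAM.
Qed.

Lemma symmetric_inv_sqrt_integral_ge :
  ((V / Num.sqrt h)%:E <= \int[mu]_z (A z * ((Num.sqrt z)^-1)%:E))%E.
Proof.
have : (\int[mu]_z (A z * (2 / Num.sqrt h)%:E) <= \int[mu]_z (A z * (g z)%:E))%E.
  rewrite (integral_open (fun=> 2 / Num.sqrt h))// (integral_open g)//.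
  apply: ge0_le_integral => //.
  - by move=> z _; rewrite mule_ge0// lee_fin divr_ge0// sqrtr_ge0.
  - exact: (mAM _ (fun=> 2 / Num.sqrt h)).
  - exact: mAM.
  move=> z /=; rewrite in_itv/= => /andP[z0 z2h].
  by rewrite lee_wpmul2l// lee_fin inv_sqrt_pair_ge.
rewrite -twice.
under eq_integral do rewrite muleC.
rewrite ge0_integralZl_EFin ?divr_ge0 ?sqrtr_ge0// AV.
(* [I] may be infinite, so the factor [2] is removed only after a case analysis. *)
set I := (\int[mu]_z _)%E.
have : (0 <= I)%E by apply: integral_ge0 => z _; exact: AM_ge0.
case: I => [I||] //=; rewrite ?leey// -EFinM -EFinD !lee_fin => _.
have := f_ge0 h; rewrite /f; lra.
Qed.

Hypothesis Amono : forall z w, z <= w -> w <= h -> (A z <= A w)%E.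

(** By symmetry [A] depends only on the distance to [h], so monotonicity below [h] suffices. *)
Let Adist z w : `|w - h| <= `|z - h| -> (A z <= A w)%E.
Proof.
have Aabs x : A x = A (h - `|x - h|).
  have [xh|hx] := leP h x.
    by rewrite ger0_norm ?subr_ge0// -Asym; congr A; ring.
  by rewrite ltr0_norm ?subr_lt0//; congr A; ring.
move=> wz; rewrite Aabs [leRHS]Aabs; apply: Amono; first by rewrite lerB.
by rewrite gerBl.
Qed.

(** An infinite value at [z] would propagate by monotonicity to all of [[z, h]], against the finite
    integral [V]. *)
Let A_fin_num z : z < h -> A z \is a fin_num.
Proof.
move=> zh; rewrite ge0_fin_numE// ltNge leye_eq; apply/eqP => Azy.
have : (\int[mu]_(w in `[z, h]) A w <= V%:E)%E.
  by rewrite -AV; apply: ge0_subset_integral.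
apply/negP; rewrite -ltNge.
rewrite (_ : \int[mu]_(w in _) _ = +oo)%E ?ltry//.
apply/eqP; rewrite -leye_eq.
have : (\int[mu]_(w in `[z, h]) (cst +oo) w <= \int[mu]_(w in `[z, h]) A w)%E.
  apply: ge0_le_integral => //; [by move=> ? _; exact: leey|exact: mAD|].
  by move=> w /=; rewrite in_itv/= => /andP[zw wh]; rewrite -Azy Amono.
rewrite integral_cst//= lebesgue_measure_itv/= lte_fin zh.
by rewrite gt0_mulye// lte_fin subr_gt0.
Qed.

(** Both summands of [g] have the same integral by reflection. The bound is [2 h] times the mean
    [2 sqrt 2 / sqrt h]. *)
Let integral_g_le :
  (\int[mu]_(z in `]0%R, (2 * h)%R[) (g z)%:E <= (4 * Num.sqrt (2 * h))%:E)%E.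
Proof.
have h20 : 0 < 2 * h by rewrite mulr_gt0.
have I := integral_inv_sqrt_le _ h20.
rewrite /g; under eq_integral do rewrite EFinD.
rewrite ge0_integralD//=; last 4 first.
- by move=> z _; rewrite lee_fin.
- exact: measurable_fin.
- by move=> z _; rewrite lee_fin.
- exact: measurable_fin.
have -> : (4 * Num.sqrt (2 * h))%:E = ((2 * Num.sqrt (2 * h))%:E + (2 * Num.sqrt (2 * h))%:E)%E.
  by rewrite -EFinD; congr EFin; ring.
apply: leeD; first exact: I.
apply: le_trans I; rewrite integral_mkcond [leRHS]integral_mkcond.
rewrite -[leRHS](@ge0_integral_reflect _ (2 * h)).
- rewrite le_eqVlt; apply/orP; left; apply/eqP; apply: eq_integral => z _.
  rewrite !patchE !mem_setE !in_itv/=.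
  by rewrite (_ : (0 < 2 * h - z < 2 * h) = (0 < z < 2 * h))//; apply/idP/idP; lra.
- apply/(measurable_restrictT _ _).1 => //.
  exact: measurable_fin.
- by apply: erestrict_ge0 => z _; rewrite lee_fin.
Qed.

(* If [g] takes its mean value [c] at [z0 = h - d], then [(A - A z0) (g - c) <= 0]
   everywhere; this is written without subtraction since [A] may be infinite. *)
Lemma unimodal_inv_sqrt_integral_le :
  (\int[mu]_z (A z * ((Num.sqrt z)^-1)%:E) <= (Num.sqrt 2 * V / Num.sqrt h)%:E)%E.
Proof.
have [d [d0 dh gP]] := @inv_sqrt_pair_crossing R h h0.
pose c : R := 2 * Num.sqrt 2 / Num.sqrt h.
have sh0 : 0 < Num.sqrt h by rewrite sqrtr_gt0.
have c0 : 0 < c by rewrite divr_gt0// mulr_gt0// sqrtr_gt0.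
have afin : A (h - d) \is a fin_num by apply: A_fin_num; lra.
pose a := fine (A (h - d)).
have aE : A (h - d) = a%:E by rewrite fineK.
have a0 : 0 <= a by rewrite fine_ge0.
have pointwise z : `]0, (2 * h)[%classic z ->
    (A z * (g z)%:E + (a * c)%:E <= c%:E * A z + a%:E * (g z)%:E)%E.
  rewrite /= in_itv/= => /andP[z0 z2h].
  have [far near_] := gP z z0 z2h.
  have dE : `|h - d - h| = d by rewrite (_ : _ - h = - d) ?normrN ?gtr0_norm//; ring.
  have [dz|zd] := leP d `|z - h|.
    have := Adist z (h - d); rewrite dE aE => /(_ dz) Aza.
    have gc : c <= g z by exact: far.
    move: (A0 z) Aza; case: (A z) => [x||] //; rewrite !lee_fin => x0 xa.
    nra.
  have := Adist (h - d) z; rewrite dE aE => /(_ (ltW zd)) aAz.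
  have gc : g z <= c by exact/near_/ltW.
  move: (A0 z) aAz; case: (A z) => [x||] //; last first.
    (* If [A z] is infinite, so is the right-hand side, because [c > 0]. *)
    by move=> _ _; rewrite gt0_muley ?lte_fin// addye// leey.
  by rewrite !lee_fin => x0 xa; nra.
have : (\int[mu]_(z in `]0%R, (2 * h)%R[) (A z * (g z)%:E + (a * c)%:E) <=
    \int[mu]_(z in `]0%R, (2 * h)%R[) (c%:E * A z + a%:E * (g z)%:E))%E.
  apply: ge0_le_integral => //.
  - by move=> z _; rewrite adde_ge0 ?AM_ge0// lee_fin mulr_ge0// ltW.
  - by apply: emeasurable_funD => //; exact: mAM.
  - apply: emeasurable_funD; apply: measurable_funeM; first exact: mAD.
    exact: measurable_fin.
have mI : measurable (`]0%R, (2 * h)%R[%classic : set R) by exact: measurable_itv.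
have mgE : measurable_fun `]0%R, (2 * h)%R[ (fun z => (g z)%:E).
  exact: measurable_fin.
rewrite ge0_integralD//=; last 3 first.
- by move=> z _; exact: AM_ge0.
- exact: mAM.
- by move=> z _; rewrite lee_fin mulr_ge0// ltW.
rewrite -integral_open// -twice integral_cst//=.
rewrite ge0_integralD//=; last 4 first.
- by move=> z _; rewrite mule_ge0// lee_fin ltW.
- by apply: measurable_funeM; exact: mAD.
- by move=> z _; rewrite mule_ge0// lee_fin.
- exact: measurable_funeM.
rewrite ge0_integralZl_EFin ?(ltW c0)//; last exact: mAD.
rewrite ge0_integralZl_EFin//; last by move=> z _; rewrite lee_fin.
have -> : (\int[mu]_(z in `]0%R, (2 * h)%R[) A z = V%:E)%E.
  rewrite -AV; have := integral_open (fun=> 1) (measurable_cst _).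
  by under eq_integral do rewrite mule1;
     under [in X in _ = X]eq_integral do rewrite mule1.
rewrite lebesgue_measure_itv/= lte_fin mulr_gt0// -EFinB subr0.
set I := (\int[mu]_z _)%E; set G := (\int[mu]_(z in _) _)%E.
move=> IG.
have {IG} : (I + I + (a * c)%:E * (2 * h)%:E <=
    c%:E * V%:E + a%:E * (4 * Num.sqrt (2 * h))%:E)%E.
  by apply: le_trans IG _; rewrite leeD2l// lee_wpmul2l// lee_fin.
have : (0 <= I)%E by apply: integral_ge0 => z _; exact: AM_ge0.
case: I => [I||] //= _; rewrite -?EFinM -?EFinD ?lee_fin.
(* As [c] is the mean of [g], the terms in [a] cancel, leaving [2 I <= c V]. *)
have -> : a * (4 * Num.sqrt (2 * h)) = a * c * (2 * h).
  rewrite /c sqrtrM//; have -> : a * (2 * Num.sqrt 2 / Num.sqrt h) * (2 * h) =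
     4 * a * Num.sqrt 2 * (h / Num.sqrt h) by field; rewrite gt_eqF.
  rewrite -{2}(@sqr_sqrtr _ h) ?ltW// expr2 mulfK ?gt_eqF//; ring.
rewrite lerD2r (_ : c * V = 2 * (Num.sqrt 2 * V / Num.sqrt h)); last first.
  by rewrite /c; field; rewrite gt_eqF.
by lra.
Qed.

End weighted.

(** * Integration over horizontal slices *)

Lemma ge0_integral_snd_ysection {d1 d2 : measure_display}
    {T1 : measurableType d1} {T2 : measurableType d2} {R : realType}
    (m1 : {sigma_finite_measure set T1 -> \bar R})
    (m2 : {sigma_finite_measure set T2 -> \bar R})
    (A : set (T1 * T2)) (k : T2 -> \bar R) :
  measurable A -> measurable_fun setT k -> (forall y, 0 <= k y)%E ->
  (\int[m1 \x m2]_(p in A) k p.2 = \int[m2]_y (m1 (ysection A y) * k y))%E.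
Proof.
move=> mA mk k0; rewrite integral_mkcond fubini_tonelli2; last 2 first.
- apply/(measurable_restrictT _ _).1 => //; apply: measurable_funTS.
  by apply: measurableT_comp => //; exact: measurable_snd.
- by apply: erestrict_ge0.
apply: eq_integral => y _; rewrite /fubini_G muleC -integral_cst//; last first.
  exact: measurable_ysection.
rewrite [RHS]integral_mkcond; apply: eq_integral => x _.
by rewrite !patchE mem_ysection.
Qed.

(** The first factor of [leb3], named so that it can carry the sigma-finite structure needed for
    Tonelli and for the product with the vertical axis. *)
Definition leb2 (R : realType) :=
  (@lebesgue_measure R \x @lebesgue_measure R)%E.

Lemma leb2_sigma_finite (R : realType) : sigma_finite setT (@leb2 R).
Proof.
pose I (n : nat) : set R := `[- n%:R, n%:R]%classic.
have fI n : (@lebesgue_measure R (I n) < +oo)%E.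
  by rewrite lebesgue_measure_itv/=; case: ifPn => _; rewrite ?ltry.
exists (fun n => I n `*` I n).
  apply/esym/seteqP; split=> // -[x y] _.
  pose m := Num.truncn (`|x| + `|y|); have := truncnS_gt (`|x| + `|y|).
  have := normr_ge0 x; have := normr_ge0 y => y0 x0 xym.
  by exists m.+1 => //; split; rewrite /I/= in_itv/= -ler_norml;
    apply/ltW/(le_lt_trans _ xym); rewrite ?lerDl ?lerDr.
move=> n; have mI : measurable (I n) by exact: measurable_itv.
split; first exact: measurableX.
rewrite /leb2 product_measure1E//; apply: lte_mul_pinfty => //; last exact: fI.
by rewrite ge0_fin_numE//; exact: fI.
Qed.

HB.instance Definition _ (R : realType) := Measure.on (@leb2 R).
HB.instance Definition _ (R : realType) :=
  Measure_isSigmaFinite.Build _ _ _ (@leb2 R) (leb2_sigma_finite R).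

(* [leb3] lives on the Borel structure generated by half-open intervals, the
   hypothesis [measurable S] on the canonical one of [R]. *)
Lemma measurable_pt3E (R : realType) : @measurable _ (pt3 R) =
  @measurable _ ((measurableTypeR R * measurableTypeR R) * measurableTypeR R)%type.
Proof.
have E2 : @measurable _ (R * R)%type =
    @measurable _ (measurableTypeR R * measurableTypeR R)%type.
  by rewrite !measurable_prod_measurableType.
by rewrite measurable_prod_measurableType [RHS]measurable_prod_measurableType E2.
Qed.

(** * Slice areas of a centrally symmetric convex solid *)

Section slices.
Context {R : realType}.
Notation mu := (@lebesgue_measure R).
Notation mR := (measurableTypeR R).
Variables (S : set (pt3 R)) (C : pt3 R).
Hypotheses (mS : @measurable _ (mR * mR * mR)%type S).
Hypotheses (cS : convex3 S) (sS : centrally_symmetric S C).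

Lemma measurable_slice_area :
  measurable_fun [set: R] (fun z => leb2 R (ysection S z)).
Proof. exact: (measurable_fun_ysection (leb2 R)). Qed.

Lemma slice_area_le (z w t : R) : 0 <= t <= 1 ->
  w = t * z + (1 - t) * (2 * zc C - z) ->
  (leb2 R (ysection S z) <= leb2 R (ysection S w))%E.
Proof.
move=> t01 wE.
have mSz y : @measurable _ (mR * mR)%type (ysection S y) by exact: measurable_ysection.
apply: (product_lebesgue_measure_le_comb _ _ (2 * xc C, 2 * yc C) t) => //.
- rewrite ysectionE => -[p1 p2] [q1 q2] s /= Sp Sq s01.
  have := cS _ _ _ Sp Sq s01; rewrite /comb3/= /xc/yc/zc/=.
  by rewrite (_ : s * w + _ = w)//; ring.
- rewrite !ysectionE => -[p1 p2] [q1 q2] /= Sp Sq.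
  by have := cS _ _ _ Sp (sS _ Sq) t01; rewrite /comb3/= /xc/yc/zc/= -wE.
Qed.

Lemma slice_area_sym (z : R) :
  (leb2 R (ysection S (2 * zc C - z)%R) = leb2 R (ysection S z))%E.
Proof.
(* With [t = 0] only the reflected slice remains; reflecting twice gives the other inequality. *)
by apply/eqP; rewrite eq_le; apply/andP; split; apply: (slice_area_le _ _ 0);
  rewrite ?lexx ?ler01//; ring.
Qed.

Lemma slice_area_mono (z w : R) : z <= w -> w <= zc C ->
  (leb2 R (ysection S z) <= leb2 R (ysection S w))%E.
Proof.
move=> zw wh; have [->//|zneqw] := eqVneq z w.
have zltw : z < w by rewrite lt_neqAle zneqw.
(* This weight solves [w = t z + (1 - t) (2 h - z)] for [t]. *)
apply: (slice_area_le _ _ ((2 * zc C - z - w) / (2 * (zc C - z)))).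
  rewrite divr_ge0 ?ler_pdivrMr/=; lra.
by field; rewrite gt_eqF//; lra.
Qed.

End slices.

Theorem theorem1 (R : realType) (S : set (pt3 R)) (C : pt3 R) (V K : R) :
  compact S -> measurable S -> convex3 S ->
  @leb3 R S = V%:E -> 0 < V ->
  centrally_symmetric S C ->
  (forall p, S p -> 0 <= zc p) ->
  (exists p, S p /\ zc p = 0) ->
  0 < zc C -> 0 < K ->
  let T := ((K^-1)%:E * \int[@leb3 R]_(p in S) ((Num.sqrt (zc p))^-1)%:E)%E in
  ((V / (K * Num.sqrt (zc C)))%:E <= T)%E /\
  (T <= (Num.sqrt 2 * V / (K * Num.sqrt (zc C)))%:E)%E.
Proof.
move=> _ mS cS SV _ sS Sge0 _ h0 K0; rewrite measurable_pt3E in mS.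
pose A (z : R) := (leb2 R (ysection S z))%E.
have mA : measurable_fun [set: R] A by exact: measurable_slice_area.
have A0 z : (0 <= A z)%E by exact: measure_ge0.
have Asym := slice_area_sym S C mS cS sS.
have Aneg z : z < 0 -> A z = 0%E.
  move=> z0; rewrite /A (_ : ysection S z = set0) ?measure0//.
  rewrite ysectionE; apply/seteqP; split=> // p /= /Sge0; rewrite /zc/=; lra.
have AV : (\int[@lebesgue_measure R]_z A z = V%:E)%E.
  by rewrite -SV; exact/esym/(product_measure_ysection (leb2 R) (@lebesgue_measure R)).
(* The integrand is constant on each horizontal slice, so Tonelli reduces the triple integral to the
   line. *)
have -> : (\int[@leb3 R]_(p in S) ((Num.sqrt (zc p))^-1)%:E =
    \int[@lebesgue_measure R]_z (A z * ((Num.sqrt z)^-1)%:E))%E.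
  apply: (ge0_integral_snd_ysection (leb2 R) (@lebesgue_measure R) S
    (fun z : R => ((Num.sqrt z)^-1)%:E)) => //.
  by apply/measurable_EFinP; exact: measurable_inv_sqrt.
move=> T; have KV x : x / (K * Num.sqrt (zc C)) = K^-1 * (x / Num.sqrt (zc C)).
  by field; rewrite !gt_eqF// sqrtr_gt0.
rewrite /T !KV ![(K^-1 * _)%:E]EFinM; split; apply: lee_wpmul2l;
  rewrite ?lee_fin ?invr_ge0 ?(ltW K0)//.
- exact: (symmetric_inv_sqrt_integral_ge _ _ A).
- apply: (unimodal_inv_sqrt_integral_le _ _ A) => // z w.
  exact: (slice_area_mono S C).
Qed.
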